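(* Let $n\ge3$, let $\mathbb T$ be a triangulation of an $n$-gon with quiddity $(c_u)_{u\in\mathbb Z}$, let $i\in\mathbb Z$, and let $\theta_{i,j+1}=\dfrac{r_{i,j+1}}{s_{i,j+1}}$ $(i-1\le j\le i+n-2)$ be the labels in the $q$-Farey labeling of $(\mathbb T,i)$. (1) For the numerators $r_{i,j+1}$ with $i-1\le j\le i+n-3$, $$\deg_{\min}r_{i,j+1}=\nu^{\mathrm{tri}}_{i-1,j}-\nu^{\mathrm{tri}}_{i,j}=\nu^{\mathrm{md}}_{i-1,j},$$ $$\deg r_{i,j+1}=\sum_{u=i}^{j}(c_u-1)-\nu^{\mathrm{tri}}_{i,j+1}-\nu^{\mathrm{tri}}_{i,j}=\nu^{\mathrm{md}}_{i-1,j}+\nu^{\mathrm{rec}}_{i,j,i+n-2}.$$ In particular, for $j=i+n-2$, $r_{i,i+n-1}=0$. (2) For the denominators $s_{i,j+1}$ with $i\le j\le i+n-2$, $$\deg_{\min}s_{i,j+1}=0,$$ $$\deg s_{i,j+1}=\sum_{u=i+1}^{j}(c_u-1)-\nu^{\mathrm{tri}}_{i+1,j+1}-\nu^{\mathrm{tri}}_{i,j}=\nu^{\mathrm{rec}}_{i+1,j,i+n-1}.$$ In particular, for $j=i-1$, $s_{i,i}=0$.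
   Context: Triangulations. Let $n\ge3$ and let $\mathcal P$ be a convex $n$-gon with vertices numbered clockwise $v_0,\dots,v_{n-1}$; indices are extended to $\mathbb Z$ by $v_{u+n}=v_u$. A triangulation $\mathbb T$ of $\mathcal P$ is by $n-3$ non-crossing diagonals; its triangles are called cells. Let $c_u$ be the number of cells having $v_u$ as a vertex; the $n$-periodic sequence $(c_u)_{u\in\mathbb Z}$ is the quiddity of $\mathbb T$. $q$-Farey labeling of $(\mathbb T,i)$. The base edge is $v_{i-1}v_i=v_{i+n-1}v_i$. Represent vertices by indices in $\{i,\dots,i+n-1\}$. Each cell is then uniquely $\{v_a,v_b,v_g\}$ with $i\le b<g<a\le i+n-1$ (clockwise order $v_a,v_b,v_g$); its base side is $v_av_b$ (the base edge itself for the cell containing the base edge; otherwise the side separating the cell from the base edge). Assign weights to sides and pairs $(r_{i,j},s_{i,j})\in\mathbb Z[q]^2$, $i\le j\le i+n-1$, to vertices, starting from the base edge and proceeding from each cell to its neighbours away from the base edge: the base edge has weight $q^{-1}$, $(r_{i,i+n-1},s_{i,i+n-1})=(0,1)$, $(r_{i,i},s_{i,i})=(1,0)$; if a cell with indices $b<g<a$ has base side $v_av_b$ of weight $q^{\ell-1}$, then $r_{i,g}=r_{i,a}+q^{\ell}r_{i,b}$, $s_{i,g}=s_{i,a}+q^{\ell}s_{i,b}$, the side $v_gv_a$ gets weight $1$ and the side $v_bv_g$ gets weight $q^\ell$. The label of $v_j$ is $\theta_{i,j}=r_{i,j}/s_{i,j}$ (fractions not reduced). Conway--Coxeter frieze of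 $\mathbb T$: the array of integers $\sigma_{k,\ell}$, $0\le\ell-k\le n+1$, determined by $\sigma_{k,k}=0$, $\sigma_{k,k+1}=1$, $\sigma_{k,k+2}=c_{k+1}$ and, recursively for $\ell-k\ge3$, $\sigma_{k,\ell-1}\sigma_{k+1,\ell}-\sigma_{k+1,\ell-1}\sigma_{k,\ell}=1$ (well defined in this range). Numbers of occurrences of $1$ (each is $0$ when the index set is empty; in particular $\nu^{\mathrm{tri}}_{i,i-1}=0$): $\nu^{\mathrm{tri}}_{k,\ell}=\#\{(a,b): k\le a,\ a+2\le b\le\ell,\ \sigma_{a,b}=1\}$; $\nu^{\mathrm{md}}_{k,\ell}=\#\{b: k+2\le b\le\ell,\ \sigma_{k,b}=1\}$; $\nu^{\mathrm{rec}}_{k,u,\ell}=\#\{(a,b): k\le a\le u,\ u+2\le b\le\ell,\ \sigma_{a,b}=1\}$. Empty sums are $0$. For a nonzero polynomial $f\in\mathbb Z[q]$, $\deg_{\min}f$ and $\deg f$ are the smallest and largest exponents of $q$ occurring in $f$. *)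

(* Defs.v *)
From mathcomp Require Import all_boot all_order all_algebra.
Set Implicit Arguments.
Unset Strict Implicit.
Unset Printing Implicit Defensive.
Import Order.TTheory GRing.Theory Num.Theory.
Local Open Scope ring_scope.

(* The vertices v_0, ..., v_(n-1) of a convex n-gon are the elements of 'I_n, in
   cyclic order.  Since the vertices are in convex position, whether two chords
   cross depends only on the cyclic order of their endpoints. *)

(* A diagonal is written with its smaller endpoint first; the last condition
   excludes the boundary edge joining v_0 and v_(n-1). *)
Definition diagonal n (d : 'I_n * 'I_n) : bool :=
  ((d.1.+2 <= d.2) && ~~ ((d.1 == 0 :> nat) && (d.2.+1 == n)))%N.

Definition crossing n (d e : 'I_n * 'I_n) : bool :=
  [|| [&& d.1 < e.1, e.1 < d.2 & d.2 < e.2]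
    | [&& e.1 < d.1, d.1 < e.2 & e.2 < d.2]]%N.

Definition triangulation n (T : {set 'I_n * 'I_n}) : Prop :=
  [/\ #|T| = (n - 3)%N,
      (forall d, d \in T -> diagonal d) &
      (forall d e, d \in T -> e \in T -> ~~ crossing d e)].

Definition boundary_edge n (x y : 'I_n) : bool :=
  ((x.+1 %% n == y) || (y.+1 %% n == x))%N.

Definition side n (T : {set 'I_n * 'I_n}) (x y : 'I_n) : bool :=
  [|| boundary_edge x y, (x, y) \in T | (y, x) \in T].

(* A triangle whose three sides are boundary edges or diagonals of a
   triangulation T contains no diagonal of T in its interior, so these triangles
   are exactly the regions cut out by T. *)
Definition cells n (T : {set 'I_n * 'I_n}) : {set {set 'I_n}} :=
  [set C : {set 'I_n} | (#|C| == 3)%N &&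
    [forall x in C, forall y in C, (x != y) ==> side T x y]].

(* The set of vertices v_u, u in us, where v_(u+n) = v_u. *)
Definition vertices n (us : seq int) : {set 'I_n} :=
  [set x : 'I_n | has (fun u => ((x : nat)%:Z == u %[mod n%:Z])%Z) us].

Definition quiddity n (T : {set 'I_n * 'I_n}) (u : int) : nat :=
  #|[set C in cells T | vertices n [:: u] \subset C]|.

(* r j and s j stand for r_(i,j) and s_(i,j).  For b < a, the side v_a v_b has
   weight q^(w b a); the base edge has weight q^(-1).  Only the values of r and s
   on {i, ..., i+n-1} are constrained. *)
Definition qFarey_labeling n (T : {set 'I_n * 'I_n}) (i : int)
    (r s : int -> {poly int}) : Prop :=
  exists w : int -> int -> int,
    [/\ w i (i + n%:Z - 1) = -1,
        (r (i + n%:Z - 1), s (i + n%:Z - 1)) = (0, 1),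
        (r i, s i) = (1, 0) &
        forall (b g a : int) (l : nat),
          i <= b -> b < g -> g < a -> a <= i + n%:Z - 1 ->
          vertices n [:: a; b; g] \in cells T ->
          w b a = l%:Z - 1 ->
          [/\ r g = r a + 'X^l * r b,
              s g = s a + 'X^l * s b,
              w g a = 0 &
              w b g = l%:Z]].

(* Only the entries sigma k l with 0 <= l - k <= n + 1 are constrained. *)
Definition frieze (n : nat) (c : int -> nat) (sigma : int -> int -> int) : Prop :=
  [/\ forall k, sigma k k = 0,
      forall k, sigma k (k + 1) = 1,
      forall k, sigma k (k + 2) = (c (k + 1))%:Z &
      forall k l, 3 <= l - k -> l - k <= n%:Z + 1 ->
        sigma k (l - 1) * sigma (k + 1) l
          - sigma (k + 1) (l - 1) * sigma k l = 1].

(* The increasing list of the integers u with k <= u <= l, empty if l < k. *)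
Definition zrange (k l : int) : seq int :=
  if l - k is Posz m then [seq k + t%:Z | t <- iota 0 m.+1] else [::].

Definition nu_md (sigma : int -> int -> int) (k l : int) : nat :=
  count (fun b => sigma k b == 1) (zrange (k + 2) l).

Definition nu_tri (sigma : int -> int -> int) (k l : int) : nat :=
  (\sum_(a <- zrange k l) count (fun b => sigma a b == 1) (zrange (a + 2) l))%N.

Definition nu_rec (sigma : int -> int -> int) (k u l : int) : nat :=
  (\sum_(a <- zrange k u) count (fun b => sigma a b == 1) (zrange (u + 2) l))%N.

(* Both degrees are meaningful only for f != 0; they are 0 when f = 0. *)
Definition degmin (f : {poly int}) : nat := find (fun c => c != 0) f.

Definition deg (f : {poly int}) : nat := (size f).-1.

(* Main.v *)
Require Import Defs.
From mathcomp Require Import all_boot all_order all_algebra zify ring.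
Import Order.TTheory GRing.Theory Num.Theory.
Set Implicit Arguments.
Unset Strict Implicit.
Unset Printing Implicit Defensive.

(* Number the vertices 0, ..., N = n - 1 starting at v_i, so that the sides and
   diagonals become arcs a < b over the base arc (0, N).  Going down from the
   base, the weight of the arc (x, y) is q^(L - 1), where L counts the arcs from x
   that reach y or further (the base excluded); hence the recursion for the labels
   makes the degree of r_g (resp. s_g) the number of arcs passing strictly over g,
   other than the base (resp. not starting at 0), with no cancellation because all
   coefficients are nonnegative.  The minimal degree of r_g counts the arcs
   (a, N), 0 < a < g.

   On the other side, c_u + 1 is the number of arcs at u, and each row of the
   frieze solves c_l f(l) = f(l-1) + f(l+1), so that f(g) = f(x) + f(y) in every
   cell x < g < y.  By positivity the entry is 1 exactly when the two vertices
   are joined by an arc.  The formulas with quiddities then count incidences of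
   vertices with arcs. *)

(** * Triangulations as sets of arcs *)

Definition noncrossing (N : nat) (e : rel nat) : Prop :=
  forall a b c d, a < b -> b < c -> c < d -> d <= N -> e a c -> e b d -> False.

(** An apex is required only on the side of an arc away from the base, which is what a descent from
    the base needs. For arcs from 0 the apex on the other side is recovered in [arc_outer_apex]. *)
Record triangulated (N : nat) (e : rel nat) : Prop := Triangulated {
  tr_noncrossing : noncrossing N e;
  tr_edge : forall a, a < N -> e a a.+1;
  tr_base : e 0 N;
  tr_apex : forall a b, a.+1 < b -> b <= N -> e a b ->
    exists g, [/\ a < g, g < b, e a g & e g b] }.

Definition long_arcs N (e : rel nat) (x y : nat) : {set 'I_N.+1 * 'I_N.+1} :=
  [set p : 'I_N.+1 * 'I_N.+1 |
    [&& x <= p.1, p.1.+1 < p.2, p.2 <= y & e p.1 p.2]].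

Definition count_long_arcs N (e : rel nat) (x y : nat) : nat :=
  #|long_arcs N e x y|.

(* Cutting [x, y] at the last neighbour g < y of x shows that noncrossing arcs
   of length at least 2 inside [x, y] number at most y - x - 1; in the case of
   equality g is an apex and both parts are again extremal. *)
Section Counting.
Context (N : nat) (e : rel nat).
Context (nc : noncrossing N e) (edge : forall a, a < N -> e a a.+1).

Lemma last_neighbour x y : x.+1 < y -> y <= N ->
  exists g, [/\ x < g, g < y, e x g & forall b, g < b -> b < y -> ~~ e x b].
Proof.
move=> xy yN.
have ex0 : exists g, [&& x < g, g < y & e x g].
  by exists x.+1; rewrite ltnSn xy edge //; lia.
have ub g : [&& x < g, g < y & e x g] -> g <= y by case/and3P=> _ /ltnW.
case: (ex_maxnP ex0 ub) => g /and3P[xg gy exg] gmax; exists g; split=> // b gb b_y.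
by apply/negP=> exb; have := gmax b; rewrite exb b_y; lia.
Qed.

(** An arc inside [x, y] that straddles g must start at x, or it would cross (x, g); then it must
    end at y, because g is the last neighbour of x before y. *)
Lemma long_arcs_split x g y : x < g -> g < y -> y <= N -> e x g ->
    (forall b, g < b -> b < y -> ~~ e x b) ->
  long_arcs N e x y \subset
    [set p in [set (inord x, inord y)] | e x y]
      :|: (long_arcs N e x g :|: long_arcs N e g y).
Proof.
move=> xg gy yN exg gmax; apply/subsetP=> -[a b]; rewrite !inE /=.
case/and4P=> xa ab b_y eab; rewrite ab eab xa b_y !andbT /=.
case: (leqP b g) => [|gb]; first by rewrite ?orbT.
case: (leqP g a) => [|ag]; first by rewrite ?orbT.
rewrite !orbF.
have ax : a = x :> nat.
  apply/eqP; rewrite eqn_leq xa andbT leqNgt; apply/negP => x_a.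
  exact: (nc x_a ag gb (ltn_ord b) exg eab).
have b_eq : b = y :> nat.
  apply/eqP; rewrite eqn_leq b_y leqNgt; apply/negP => by_.
  by move: eab; rewrite ax (negPf (gmax _ gb by_)).
rewrite -ax -b_eq eab andbT; apply/eqP; congr pair; apply/val_inj; rewrite /= inordK //.
Qed.

Lemma card_long_arcs_split x g y : x < g -> g < y -> y <= N -> e x g ->
    (forall b, g < b -> b < y -> ~~ e x b) ->
  count_long_arcs N e x y <= e x y + (count_long_arcs N e x g + count_long_arcs N e g y).
Proof.
move=> xg gy yN exg gmax; rewrite /count_long_arcs.
apply: leq_trans (subset_leq_card (long_arcs_split xg gy yN exg gmax)) _.
apply: leq_trans (leq_card_setU _ _) _; apply: leq_add; last exact: leq_card_setU.
case: (e x y); last by rewrite (_ : [set _ in _ | _] = set0) ?cards0 //;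
  apply/setP=> p; rewrite !inE andbF.
by rewrite -[X in _ <= X](cards1 (inord x : 'I_N.+1, inord y : 'I_N.+1)) subset_leq_card //;
  apply/subsetP=> p; rewrite !inE andbT.
Qed.

Lemma card_long_arcs x y : x < y -> y <= N -> count_long_arcs N e x y < y - x.
Proof.
have [m] := ubnP (y - x); elim: m x y => // m IH x y ym xy yN.
case: (ltnP x.+1 y) => [xy1|yx].
  have [g [xg gy exg gmax]] := last_neighbour xy1 yN.
  have := card_long_arcs_split xg gy yN exg gmax.
  have := IH x g _ xg _; have := IH g y _ gy yN.
  by case: (e x y) => /=; lia.
rewrite /count_long_arcs (_ : long_arcs N e x y = set0) ?cards0 ?subn_gt0 //.
apply/setP=> p; rewrite !inE; apply/negP=> /and4P[]; lia.
Qed.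

Lemma card_long_arcs_apex x y : x.+1 < y -> y <= N ->
    y - x <= (count_long_arcs N e x y).+1 ->
  e x y /\ exists g, [/\ x < g, g < y, g - x <= (count_long_arcs N e x g).+1 &
                        y - g <= (count_long_arcs N e g y).+1].
Proof.
move=> xy yN tight.
have [g [xg gy exg gmax]] := last_neighbour xy yN.
have := card_long_arcs_split xg gy yN exg gmax.
have gN : g <= N by lia.
have := card_long_arcs xg gN; have := card_long_arcs gy yN.
case: (e x y) => H1 H2 H3; last by lia.
by split=> //; exists g; split=> //; lia.
Qed.

Lemma tight_arc x y : x < y -> y <= N ->
  y - x <= (count_long_arcs N e x y).+1 -> e x y.
Proof.
move=> xy yN tight; case: (ltnP x.+1 y) => [xy1|yx].
  by have [] := card_long_arcs_apex xy1 yN tight.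
by rewrite (_ : y = x.+1) ?edge; lia.
Qed.

Lemma tight_apex x y a b : x < y -> y <= N ->
    y - x <= (count_long_arcs N e x y).+1 ->
    x <= a -> a.+1 < b -> b <= y -> e a b ->
  exists g, [/\ a < g, g < b, e a g & e g b].
Proof.
have [m] := ubnP (y - x); elim: m x y => // m IH x y ym xy yN tight xa ab b_y eab.
have xy1 : x.+1 < y by lia.
have [exy [g [xg gy tl tr]]] := card_long_arcs_apex xy1 yN tight.
have gN : g <= N by lia.
have exg := tight_arc xg gN tl; have egy := tight_arc gy yN tr.
case: (leqP b g) => [bg|gb]; first by apply: (IH x g) => //; lia.
case: (leqP g a) => [ga|ag]; first by apply: (IH g y) => //; lia.
(* Here a < g < b. The arc crosses (x, g) unless a = x, and (g, y) unless b = y, so it is (x, y)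
   itself, with apex g. *)
case: (ltnP x a) => [x_a|ax].
  by case: (nc x_a ag gb (leq_trans b_y yN) exg eab).
case: (ltnP b y) => [by_|yb].
  by case: (nc ag gb by_ yN eab egy).
have -> : a = x by lia.
have -> : b = y by lia.
by exists g.
Qed.

Lemma triangulated_of_card : 0 < N ->
  N <= (count_long_arcs N e 0 N).+1 -> triangulated N e.
Proof.
move=> N0 tight; split=> //; first by apply: tight_arc; rewrite ?subn0.
by move=> a b ab bN eab; apply: (@tight_apex 0 N); rewrite ?subn0.
Qed.

End Counting.

(** Induction from the base arc, in the order in which the labels are computed. Every arc is
    reached: an arc inside [x, y] other than (x, y) crosses neither (x, g) nor (g, y), hence lies in
    one of the two parts. *)
Lemma arc_ind N e (Q : nat -> nat -> Prop) : triangulated N e -> Q 0 N ->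
    (forall x g y, x < g -> g < y -> y <= N -> e x g -> e g y -> e x y ->
       Q x y -> Q x g /\ Q g y) ->
  forall a b, a < b -> b <= N -> e a b -> Q a b.
Proof.
move=> [nc edge base apex] Q0 Qs.
suff H m : forall x y, y - x < m -> x < y -> y <= N -> e x y -> Q x y ->
    forall a b, x <= a -> a < b -> b <= y -> e a b -> Q a b.
  by move=> a b ab bN; apply: (H N.+1 0 N); rewrite ?subn0 //; lia.
elim: m => // m IH x y ym xy yN exy Qxy a b xa ab b_y eab.
case: (ltnP x.+1 y) => [xy1|yx]; last first.
  have -> : a = x by lia.
  by have -> : b = y by lia.
have [g [xg gy exg egy]] := apex _ _ xy1 yN exy.
have [Ql Qr] := Qs _ _ _ xg gy yN exg egy exy Qxy.
case: (leqP b g) => [bg|gb]; first by apply: (IH x g) => //; lia.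
case: (leqP g a) => [ga|ag]; first by apply: (IH g y) => //; lia.
case: (ltnP x a) => [x_a|ax].
  by case: (nc _ _ _ _ x_a ag gb (leq_trans b_y yN) exg eab).
case: (ltnP b y) => [by_|yb].
  by case: (nc _ _ _ _ ag gb by_ yN eab egy).
have -> : a = x by lia.
by have -> : b = y by lia.
Qed.

(** * The fan recursion *)

Definition row (e : rel nat) (x lo hi : nat) : nat := \sum_(lo <= b < hi) e x b.
Definition col (e : rel nat) (y lo hi : nat) : nat := \sum_(lo <= a < hi) e a y.
(** Boundary edges and the base are included, so this will be the quiddity plus 1. *)
Definition degree N (e : rel nat) (g : nat) : nat := col e g 0 g + row e g g.+1 N.+1.

Lemma row_cat e x lo hi m : lo <= m -> m <= hi ->
  row e x lo hi = row e x lo m + row e x m hi.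
Proof. exact: big_cat_nat. Qed.

Lemma col_cat e y lo hi m : lo <= m -> m <= hi ->
  col e y lo hi = col e y lo m + col e y m hi.
Proof. exact: big_cat_nat. Qed.

Lemma row1 e x m : row e x m m.+1 = e x m.
Proof. exact: big_nat1. Qed.

Lemma col1 e y m : col e y m m.+1 = e m y.
Proof. exact: big_nat1. Qed.

Lemma row0 (e : rel nat) x lo hi : (forall b, lo <= b -> b < hi -> e x b -> False) ->
  row e x lo hi = 0.
Proof.
move=> H; rewrite /row big_nat big1 // => b /andP[l h].
by case E: (e x b) => //; case: (H b l h E).
Qed.

Lemma col0 (e : rel nat) y lo hi : (forall a, lo <= a -> a < hi -> e a y -> False) ->
  col e y lo hi = 0.
Proof.
move=> H; rewrite /col big_nat big1 // => b /andP[l h].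
by case E: (e b y) => //; case: (H b l h E).
Qed.

Section Apex.
Context (N : nat) (e : rel nat) (tr : triangulated N e).
Context (x g y : nat) (xg : x < g) (gy : g < y) (yN : y <= N).
Context (exg : e x g) (egy : e g y) (exy : e x y).

Lemma row_apex : row e x x.+1 y = (row e x x.+1 g).+1.
Proof.
rewrite (row_cat _ _ xg (ltnW gy)) (row_cat _ _ (leqnSn g) gy) row1 exg.
rewrite [row e x g.+1 y]row0 ?addn1 // => b gb b_y exb.
exact: (tr_noncrossing tr xg gb b_y yN exb egy).
Qed.

Lemma col_apex : col e y x.+1 y = (col e y g.+1 y).+1.
Proof.
rewrite (col_cat _ _ (ltnW xg : x.+1 <= g.+1) gy) (col_cat _ _ xg (leqnSn g)) col1 egy.
rewrite [col e y x.+1 g]col0 // => b xb b_g eby.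
exact: (tr_noncrossing tr xb b_g gy yN exg eby).
Qed.

(** The arc (x, y) confines all neighbours of g to [x, y]; the constant 2 accounts for x and y. *)
Lemma degree_apex : degree N e g = (col e g x.+1 g + row e g g.+1 y).+2.
Proof.
rewrite /degree (col_cat _ _ (leq0n x) (ltnW xg)) (col_cat _ _ (leqnSn x) xg) col1 exg.
have yN' : y <= N.+1 by exact: leqW.
rewrite (row_cat _ _ gy yN') (row_cat _ _ (leqnSn y) (yN : y < N.+1)) row1 egy.
rewrite (@col0 e g 0 x) => [|a _ ax eag]; last first.
  exact: (tr_noncrossing tr ax xg gy yN eag exy).
rewrite (@row0 e g y.+1 N.+1) => [|b yb bN egb]; last first.
  exact: (tr_noncrossing tr xg gy yb bN exy egb).
by rewrite /=; lia.
Qed.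

End Apex.

Section Fan.
Local Open Scope ring_scope.
Context (N : nat) (e : rel nat) (tr : triangulated N e) (f : nat -> int).
Context (frec : forall l, (0 < l)%N -> (l < N)%N ->
  f l.-1 + f l.+1 = ((degree N e l)%:Z - 1) * f l).

(** Turning around x from y down to x + 1, each cell adds one f x. By induction on both parts,
    f(g-1) and f(g+1) are known at the apex g, and the recurrence there collapses to f g = f x + f
    y. *)
Lemma fan x y : (x < y)%N -> (y <= N)%N -> e x y ->
  f x.+1 = f y + (row e x x.+1 y)%:Z * f x /\
  f y.-1 = f x + (col e y x.+1 y)%:Z * f y.
Proof.
have [m] := ubnP (y - x); elim: m x y => // m IH x y ym xy yN exy.
case: (ltnP x.+1 y) => [xy1|yx]; last first.
  have -> : y = x.+1 by lia.
  by rewrite /row /col !big_geq // !mul0r !addr0.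
have [g [xg gy exg egy]] := tr_apex tr xy1 yN exy.
have [E1 E2] := IH x g ltac:(lia) xg (leq_trans (ltnW gy) yN) exg.
have [E3 E4] := IH g y ltac:(lia) gy yN egy.
rewrite (row_apex tr xg gy yN exg egy) (col_apex tr xg gy yN exg egy).
have := @frec g; rewrite E2 E3 (degree_apex tr xg gy yN exg egy exy).
move=> /(_ ltac:(lia) ltac:(lia)) fg.
have {}fg : f g = f x + f y by move: fg; lia.
by rewrite E1 E4 fg; split; lia.
Qed.

Lemma fan_apex x g y : (x < g)%N -> (g < y)%N -> (y <= N)%N ->
  e x g -> e g y -> e x y -> f g = f x + f y.
Proof.
move=> xg gy yN exg egy exy.
have [_ E2] := fan xg (leq_trans (ltnW gy) yN) exg.
have [E3 _] := fan gy yN egy.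
have := @frec g; rewrite E2 E3 (degree_apex tr xg gy yN exg egy exy).
move=> /(_ ltac:(lia) ltac:(lia)); lia.
Qed.

End Fan.

(** * Positivity of a frieze row and the location of its ones *)

Section Frieze.
Local Open Scope ring_scope.
Context (N : nat) (e : rel nat) (tr : triangulated N e) (f : nat -> int).
Context (frec : forall l, (0 < l)%N -> (l < N)%N ->
  f l.-1 + f l.+1 = ((degree N e l)%:Z - 1) * f l).
Context (N0 : (0 < N)%N) (f0 : f 0%N = 0) (f1 : f 1%N = 1).

Lemma frieze_base : f N = 1.
Proof.
by have [] := fan tr frec N0 (leqnn N) (tr_base tr); rewrite f0 f1 mulr0 addr0 => ->.
Qed.

(** Descending from the base, f g = f x + f y preserves positivity away from 0. In a cell with x = 0
    the sum is 0 + f y, so the value 1 is passed on to every neighbour of 0. *)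
Lemma frieze_arc a b : (a < b)%N -> (b <= N)%N -> e a b ->
  0 < f b /\ (f a = 0 <-> a = 0%N) /\ 0 <= f a /\ (a = 0%N -> f b = 1).
Proof.
move: a b; apply: (arc_ind tr); first by rewrite frieze_base f0.
move=> x g y xg gy yN exg egy exy.
have -> := fan_apex tr frec xg gy yN exg egy exy.
case=> fy [fx [fx0 fy1]].
have x0 : x = 0%N -> f x = 0 by tauto.
have x0' : f x = 0 -> x = 0%N by tauto.
do !split; try lia; move=> H; move: (x0 H) (fy1 H); lia.
Qed.

Lemma frieze_gt0 b : (0 < b)%N -> (b <= N)%N -> 0 < f b.
Proof.
case: b => // b _ bN.
by have [] := frieze_arc (ltnSn b) bN (tr_edge tr bN).
Qed.

(** If x > 0, the apex value f x + f y is a sum of two positive integers, hence not 1. So an apex of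
    value 1 has x = 0 and is joined to 0 by the side (x, g). *)
Lemma frieze_eq1 b : (0 < b)%N -> (b <= N)%N -> (f b == 1) = e 0%N b.
Proof.
move=> b0 bN; apply/idP/idP; last first.
  by move=> e0b; have [_ [_ [_ /(_ erefl) ->]]] := frieze_arc b0 bN e0b.
suff H : forall x y, (x < y)%N -> (y <= N)%N -> e x y ->
    (f x == 1 -> x = 0%N \/ e 0%N x) /\ (f y == 1 -> e 0%N y).
  case: b b0 bN => // b _ bN.
  by have [_] := H _ _ (ltnSn b) bN (tr_edge tr bN).
apply: (arc_ind tr); first by rewrite f0 (tr_base tr).
move=> x g y xg gy yN exg egy exy [Hx Hy].
suff Hg : f g == 1 -> e 0%N g by do !split => //; right; apply: Hg.
have -> := fan_apex tr frec xg gy yN exg egy exy.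
case: (posnP x) => [x0|x_gt0]; first by move=> _; rewrite -x0.
have xN : (x <= N)%N by lia.
have y0 : (0 < y)%N by lia.
by have := frieze_gt0 x_gt0 xN; have := frieze_gt0 y0 yN; lia.
Qed.

End Frieze.

(** * Degrees of the labels *)

Section Spans.
Local Open Scope ring_scope.

(** Nonnegativity of all coefficients is part of the invariant: it rules out cancellation, so that
    sums take the minimum of the [m] and the maximum of the [d]. *)
Definition spans (f : {poly int}) (m d : nat) : Prop :=
  [/\ forall k, 0 <= f`_k, 0 < f`_m, 0 < f`_d &
      forall k, f`_k != 0 -> (m <= k <= d)%N].

Lemma spans1 : spans 1 0 0.
Proof.
split; rewrite ?coef1 // => k; rewrite coef1; first by case: (k == 0)%N.
by case: k.
Qed.

Lemma spans_neq0 f m d : spans f m d -> f != 0.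
Proof. by case=> _ fm _ _; apply: contraTneq fm => ->; rewrite coef0 ltxx. Qed.

Lemma spans_deg f m d : spans f m d -> deg f = d.
Proof.
move=> sf; have f0 := spans_neq0 sf; case: sf => _ _ fd fk; rewrite /deg.
apply/eqP; rewrite eqn_leq; apply/andP; split.
  by have /fk/andP[] : f`_(size f).-1 != 0 by rewrite -lead_coefE lead_coef_eq0.
have : (d < size f)%N by apply: contraTltn fd => /(nth_default 0) ->; rewrite ltxx.
by lia.
Qed.

Lemma spans_degmin f m d : spans f m d -> degmin f = m.
Proof.
case=> _ fm _ fk; rewrite /degmin.
have mf : (m < size f)%N by apply: contraTltn fm => /(nth_default 0) ->; rewrite ltxx.
apply/eqP; rewrite eqn_leq; apply/andP; split.
  by rewrite leqNgt; apply/negP => /(before_find 0); rewrite lt0r_neq0.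
have hf : has (fun c => c != 0) f.
  by apply/(has_nthP 0); exists m => //; rewrite lt0r_neq0.
by have /fk/andP[] := nth_find 0 hf.
Qed.

Lemma spansMX f m d l : spans f m d -> spans ('X^l * f) (l + m) (l + d).
Proof.
case=> f0 fm fd fk; split=> [k|||k]; rewrite coefXnM.
- by case: ifP.
- by rewrite ltnNge leq_addr addKn.
- by rewrite ltnNge leq_addr addKn.
by case: ltnP => [_|lk /fk]; [rewrite eqxx | lia].
Qed.

Lemma spansD f h m m' d d' : spans f m d -> spans h m' d' ->
  spans (f + h) (minn m m') (maxn d d').
Proof.
case=> f0 fm fd fk [h0 hm hd hk].
split=> [k|||k]; rewrite coefD.
- exact: addr_ge0.
- by case: leqP => _; [exact: ltr_wpDr | exact: ltr_wpDl].
- by case: leqP => _; [exact: ltr_wpDl | exact: ltr_wpDr].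
case: (eqVneq f`_k 0) => [->|/fk]; last by lia.
by rewrite add0r => /hk; lia.
Qed.

End Spans.

(** * Weights, labels and the arcs passing over a vertex *)

Section Labels.
Context (N : nat) (e : rel nat) (tr : triangulated N e) (N0 : 0 < N).

(* The upper bound N + (0 < x) leaves out the base arc (0, N). *)
Definition reach (x y : nat) : nat := row e x y (N + (0 < x)).

(** Counts arcs passing strictly over g. It will be the degree of the numerator for [lo] = 0 and of
    the denominator for [lo] = 1. *)
Definition over (lo g : nat) : nat := \sum_(lo <= a < g) reach a g.+1.

Lemma reach_cat x y z : y <= z -> z <= N -> reach x y = row e x y z + reach x z.
Proof. by move=> yz zN; apply: row_cat => //; lia. Qed.

Lemma leq_reach x y z : y <= z -> reach x z <= reach x y.
Proof.
move=> yz; rewrite /reach; case: (leqP z (N + (0 < x))) => zN.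
  by rewrite (row_cat e x yz zN) leq_addl.
by rewrite {1}/row big_geq // ltnW.
Qed.

Lemma reach_inner x z a : x < a -> a < z -> z <= N -> e x z -> reach a z.+1 = 0.
Proof.
move=> xa az zN exz; apply: row0 => b zb bN eab.
by apply: (tr_noncrossing tr xa az zb _ exz eab); lia.
Qed.

Lemma over_inner lo x z : lo <= x.+1 -> x < z -> z <= N -> e x z ->
  over lo z = \sum_(lo <= a < x.+1) reach a z.+1.
Proof.
move=> lox xz zN exz; rewrite /over (big_cat_nat lox xz) /=.
rewrite [X in _ + X]big_nat [X in _ + X]big1 ?addn0 // => a /andP[xa az].
exact: (@reach_inner x z).
Qed.

Section AtApex.
Context (x g y : nat) (xg : x < g) (gy : g < y) (yN : y <= N).
Context (exg : e x g) (egy : e g y) (exy : e x y).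

(** With [reach_apexr], this is the weight rule: if (x, y) has weight q^(l-1), then (x, g) has
    weight q^l and (g, y) has weight 1. *)
Lemma reach_apexl : reach x g = (reach x y).+1.
Proof.
rewrite (reach_cat x (ltnW gy) yN) (row_cat _ _ (leqnSn g) gy) row1 exg.
rewrite row0 // => b gb b_y exb.
exact: (tr_noncrossing tr xg gb b_y yN exb egy).
Qed.

Lemma reach_apexr : reach g y = 1.
Proof.
rewrite /reach (row_cat _ _ (leqnSn y)); last by lia.
rewrite row1 egy row0 // => b yb bN egb.
by apply: (tr_noncrossing tr xg gy yb _ exy egb); lia.
Qed.

(** An arc over g starts at x and reaches y, or starts before x. The latter are exactly the arcs
    over x, since none of these can end strictly between x and y. *)
Lemma over_apex lo : lo <= x -> over lo g = over lo x + reach x y.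
Proof.
move=> lox; rewrite (@over_inner lo x) ?(leqW lox) //; last by lia.
rewrite big_nat_recr //= (reach_cat x gy yN) row0 ?add0n; last first.
  by move=> b gb b_y exb; apply: (tr_noncrossing tr xg gb b_y yN exb egy).
congr (_ + _); apply: eq_big_nat => a /andP[_ ax].
rewrite (@reach_cat a x.+1 g.+1); [|lia|lia].
rewrite row0 // => b xb b_g eab.
by apply: (tr_noncrossing tr ax xb _ yN eab exy); lia.
Qed.

Lemma over_apex_gt lo : x < lo -> over lo g = 0.
Proof.
move=> xlo; rewrite /over big_nat big1 // => a /andP[loa ag].
by apply: (@reach_inner x g) => //; lia.
Qed.

(** An arc over y starts no later than x, hence also passes over g. So the term of the label of g
    that comes from x has the dominant degree. *)
Lemma leq_over_apex lo : over lo y <= over lo g.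
Proof.
case: (leqP lo x) => [lox|xlo].
  rewrite (@over_inner lo x) ?(leqW lox) //; last by lia.
  rewrite [leqRHS](@over_inner lo x) ?(leqW lox) //; last by lia.
  by apply: leq_sum => a _; apply: leq_reach; lia.
rewrite {1}/over big_nat big1 // => a /andP[loa ay].
by apply: (@reach_inner x y) => //; lia.
Qed.

(** An arc to N starting strictly between x and g would cross (x, g). The factor [0 < x] excludes
    the base. *)
Lemma col_base_apex : col e N 1 g = col e N 1 x + (0 < x) * e x N.
Proof.
have inner lo : x < lo -> col e N lo g = 0.
  move=> xlo; apply: col0 => a loa ag eaN.
  have xa : x < a by lia.
  by apply: (tr_noncrossing tr xa ag _ (leqnn N) exg eaN); lia.
case: (posnP x) => [x0|x0].
  by rewrite inner ?x0 // /col big_geq.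
rewrite (@col_cat e N 1 g x) //; last by lia.
by rewrite (col_cat _ _ (leqnSn x) xg) col1 inner // mul1n addn0.
Qed.

Lemma col_base_apexr : y < N -> col e N 1 g = col e N 1 y.
Proof.
move=> y_N; rewrite (@col_cat e N 1 y g); [|lia|lia].
rewrite [X in _ + X]col0 ?addn0 // => a ga ay eaN.
have xa : x < a by lia.
exact: (tr_noncrossing tr xa ay y_N (leqnn N) exy eaN).
Qed.

End AtApex.

Local Open Scope ring_scope.

(** Numerators and denominators obey the same recursion, so it is stated for one sequence [f]; they
    differ in their values at 0 and N. *)
Definition farey_labeling (w : nat -> nat -> int) (f : nat -> {poly int}) : Prop :=
  forall b g a (l : nat), (b < g)%N -> (g < a)%N -> (a <= N)%N ->
    e b g -> e g a -> e b a -> w b a = l%:Z - 1 ->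
    [/\ f g = f a + 'X^l * f b, w g a = 0 & w b g = l%:Z].

Context (w : nat -> nat -> int) (w0 : w 0 N = -1).

Lemma weight_arc f : farey_labeling w f ->
  forall x y, (x < y)%N -> (y <= N)%N -> e x y -> w x y = (reach x y)%:Z - 1.
Proof.
move=> hf; apply: (arc_ind tr).
  by rewrite w0 /reach addn0 /row big_geq.
move=> x g y xg gy yN exg egy exy wxy.
have [_ -> ->] := hf _ _ _ _ xg gy yN exg egy exy wxy.
by rewrite (reach_apexl xg gy yN exg egy) (reach_apexr xg gy yN exg egy exy); lia.
Qed.

Lemma label_apex f : farey_labeling w f ->
  forall x g y, (x < g)%N -> (g < y)%N -> (y <= N)%N -> e x g -> e g y -> e x y ->
  f g = f y + 'X^(reach x y) * f x.
Proof.
move=> hf x g y xg gy yN exg egy exy.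
have wxy := weight_arc hf (ltn_trans xg gy) yN exy.
by have [] := hf _ _ _ _ xg gy yN exg egy exy wxy.
Qed.

Lemma denominator_spans s : farey_labeling w s -> s 0%N = 0 -> s N = 1 ->
  forall g, (0 < g)%N -> (g <= N)%N -> spans (s g) 0 (over 1 g).
Proof.
move=> hs s0 sN.
suff H : forall x y, (x < y)%N -> (y <= N)%N -> e x y ->
    ((0 < x)%N -> spans (s x) 0 (over 1 x)) /\ spans (s y) 0 (over 1 y).
  by case=> // g _ gN; have [_] := H _ _ (ltnSn g) gN (tr_edge tr gN).
apply: (arc_ind tr).
  split=> //; rewrite sN (_ : over 1 N = 0%N); first exact: spans1.
  rewrite /over big_nat big1 // => a /andP[a0 aN].
  by apply: row0 => b; lia.
move=> x g y xg gy yN exg egy exy [Sx Sy].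
suff Sg : spans (s g) 0 (over 1 g) by [].
rewrite (label_apex hs xg gy yN exg egy exy).
have gy_over := leq_over_apex xg gy yN exg egy exy 1.
(* If x = 0, then s_x = 0 and the label of y is copied to g; no arc starting after 0 passes over g
   or y, so both degrees are 0. *)
case: (posnP x) => [x0|x0].
  rewrite x0 s0 mulr0 addr0.
  have g0 : over 1 g = 0%N.
    by apply: (over_apex_gt xg gy yN exg egy exy); rewrite x0.
  by move: gy_over Sy; rewrite g0 leqn0 => /eqP ->.
have := spansD Sy (spansMX (reach x y) (Sx x0)).
rewrite min0n addnC -(over_apex xg gy yN exg egy exy) //.
by rewrite (maxn_idPr gy_over).
Qed.

Lemma numerator_spans r : farey_labeling w r -> r 0%N = 1 -> r N = 0 ->
  forall g, (g < N)%N -> spans (r g) (col e N 1 g) (over 0 g).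
Proof.
move=> hr r0 rN.
suff H : forall x y, (x < y)%N -> (y <= N)%N -> e x y ->
    spans (r x) (col e N 1 x) (over 0 x) /\
    ((y < N)%N -> spans (r y) (col e N 1 y) (over 0 y)).
  by move=> g gN; have [] := H _ _ (ltnSn g) gN (tr_edge tr gN).
apply: (arc_ind tr).
  split=> [|]; last by rewrite ltnn.
  by rewrite r0 /col /over !big_geq //; exact: spans1.
move=> x g y xg gy yN exg egy exy [Rx Ry].
suff Rg : spans (r g) (col e N 1 g) (over 0 g) by split=> // /Ry.
rewrite (label_apex hr xg gy yN exg egy exy).
have Rx' := spansMX (reach x y) Rx.
have Mg := col_base_apex xg gy yN exg egy exy.
move: (Rx'); rewrite [X in spans _ _ X]addnC -(over_apex xg gy yN exg egy exy) //.
(* If y = N, only q^l r_x remains, with l = 1 for x > 0 and l = 0 for x = 0. If y < N, the minimal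
   degree comes from r_y and the degree from q^l r_x. *)
move: yN; rewrite leq_eqVlt => /orP[/eqP yN|yN].
  rewrite yN rN add0r Mg; congr spans.
  rewrite addnC /reach; congr (_ + _)%N; case: (posnP x) => [x0|x0].
    by rewrite addn0 /row big_geq.
  by rewrite mul1n addn1 row1.
have gy_over := leq_over_apex xg gy (ltnW yN) exg egy exy 0.
move=> Rxg; have := spansD (Ry yN) Rxg.
rewrite (maxn_idPr gy_over) -(col_base_apexr xg gy (ltnW yN) exg egy exy) //.
rewrite (minn_idPl _) // Mg addnC leq_add2r.
case: (posnP x) => // x0; rewrite mul1n.
by rewrite /reach x0 addn1 (@row_cat _ _ _ _ N) ?row1 ?leq_addl // ltnW.
Qed.

End Labels.

(** * Counting incidences *)

(** This and [rec_count] become the triangular and rectangular numbers of ones once ones are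
    identified with arcs; the bound [hi] is exclusive. *)
Definition tri_count (e : rel nat) (lo hi : nat) : nat :=
  \sum_(lo <= a < hi) row e a a.+2 hi.

Definition rec_count (e : rel nat) (lo g hi : nat) : nat :=
  \sum_(lo <= a < g) row e a g.+1 hi.

Lemma tri_countS (e : rel nat) lo h :
  tri_count e lo h.+1 = tri_count e lo h + col e h lo h.-1.
Proof.
rewrite /tri_count /col; case: (leqP lo h) => [loh|hlo]; last first.
  by rewrite !big_geq //; lia.
have row_empty lo' hi' a : hi' <= lo' -> row e a lo' hi' = 0 by exact: big_geq.
rewrite big_nat_recr //= row_empty ?addn0; last by lia.
have step a : a < h.-1 -> row e a a.+2 h.+1 = row e a a.+2 h + e a h.
  by move=> ah; rewrite (@row_cat _ _ _ _ h) ?row1 //; lia.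
case: (ltnP lo h) => [lo_h|hlo]; last by rewrite !big_geq //; lia.
case: h loh step lo_h => // h loh step lo_h.
rewrite !big_nat_recr //= !row_empty ?addn0 -?big_split /=; [|lia..].
by apply: eq_big_nat => a /andP[_ ah]; exact: step.
Qed.

(** When the vertex passed over moves from g to g + 1, the arcs ending at g + 1 are lost and those
    of length at least 2 starting at g are gained. *)
Lemma rec_countS (e : rel nat) lo g hi : lo <= g -> g.+1 < hi ->
  rec_count e lo g.+1 hi + col e g.+1 lo g = rec_count e lo g hi + row e g g.+2 hi.
Proof.
move=> log ghi; rewrite /rec_count /col big_nat_recr //= addnAC -big_split /=.
congr (_ + _); apply: eq_big_nat => a _.
by rewrite (row_cat _ _ (leqnSn g.+1) ghi) row1 addnC.
Qed.

Section Incidences.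
Context (N : nat) (e : rel nat) (tr : triangulated N e).

Lemma col_edge g : 0 < g -> g <= N -> col e g 0 g = (col e g 0 g.-1).+1.
Proof.
case: g => // g _ gN.
by rewrite (col_cat _ _ (leq0n g) (leqnSn g)) col1 (tr_edge tr gN) addn1.
Qed.

Lemma row_edge g hi : g < N -> g.+1 < hi -> row e g g.+1 hi = (row e g g.+2 hi).+1.
Proof.
by move=> gN ghi; rewrite (row_cat _ _ (leqnSn g.+1) ghi) row1 (tr_edge tr gN).
Qed.

(* An arc with both ends u < g is counted twice; one with a single such end ends
   at g, at N, or passes over g. *)
Lemma sum_degree_numerator g : g < N ->
  \sum_(0 <= u < g) degree N e u =
    2 * g + tri_count e 0 g.+1 + tri_count e 0 g + col e N 1 g + rec_count e 0 g N.
Proof.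
elim: g => [|g IH] gN.
  by rewrite /tri_count /col /rec_count !big_nat1 !big_geq // /row big_geq.
rewrite big_nat_recr //= IH ?(ltnW gN) //.
have := rec_countS e (leq0n g) gN; rewrite (tri_countS e 0 g.+1) /=.
rewrite /degree row_edge ?(ltnW gN) //; last by lia.
rewrite (row_cat _ _ gN (leqnSn N)) row1.
(* For g > 0 the two edges at g give the increment 2, and (g, N) is counted by [col]. For g = 0 the
   increment 2 comes from the edge (0, 1) and the base. *)
case: (posnP g) => [g0|g0].
  rewrite g0 (tr_base tr) (tri_countS e 0 0) /= /col !big_geq //.
  by lia.
rewrite (tri_countS e 0 g) col_edge //; last by lia.
by rewrite (col_cat _ _ g0 (leqnSn g)) col1; lia.
Qed.

(** Here an arc with a single end in [1, g) starts at 0, ends at g or passes over g; the boundary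
    edges contribute the term 2 (g - 1). *)
Lemma sum_degree_denominator g : 0 < g -> g <= N ->
  \sum_(1 <= u < g) degree N e u =
    2 * g.-1 + tri_count e 1 g.+1 + tri_count e 0 g + rec_count e 1 g N.+1.
Proof.
case: g => // g _; elim: g => [|g IH] gN.
  rewrite /tri_count /rec_count !big_nat1 /row !big_geq //.
rewrite big_nat_recr //= IH ?(ltnW gN) //.
have := @rec_countS e 1 g.+1 N.+1 isT gN.
rewrite (tri_countS e 1 g.+2) (tri_countS e 0 g.+1) /=.
by rewrite /degree row_edge // col_edge ?(ltnW gN) //=; lia.
Qed.

Lemma over_denominator g : over N e 1 g = rec_count e 1 g N.+1.
Proof.
apply: eq_big_nat => a /andP[a0 _]; by rewrite /reach a0 addn1.
Qed.

Lemma over_numerator g : g < N -> over N e 0 g = col e N 1 g + rec_count e 0 g N.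
Proof.
case: g => [|g] gN; first by rewrite /over /col /rec_count !big_geq.
rewrite /over /rec_count /col !(big_ltn (ltn0Sn g)) /= {1}/reach addn0.
rewrite addnCA; congr (_ + _); rewrite -big_split /=.
apply: eq_big_nat => a /andP[a0 _].
by rewrite /reach a0 addn1 (row_cat _ _ gN (leqnSn N)) row1 addnC.
Qed.

End Incidences.

(** * The polygon seen from a vertex *)

Section Vertices.
Context (N : nat) (N2 : 2 <= N).
Local Open Scope ring_scope.

Definition vtx (u : int) : 'I_N.+1 := inord `|(u %% N.+1%:Z)%Z|%N.

Lemma val_vtx u : (vtx u : nat)%:Z = (u %% N.+1%:Z)%Z.
Proof.
have u0 : 0 <= (u %% N.+1%:Z)%Z by apply: modz_ge0.
have uN : (u %% N.+1%:Z)%Z < N.+1%:Z by apply: ltz_pmod.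
by rewrite /vtx inordK; lia.
Qed.

Lemma vtx_eq u v : (u = v %[mod N.+1%:Z])%Z -> vtx u = vtx v.
Proof. by move=> uv; rewrite /vtx uv. Qed.

Lemma vtx_period u : vtx (u + N.+1%:Z) = vtx u.
Proof. by apply: vtx_eq; rewrite modzDr. Qed.

Lemma vtx_pred i : vtx (i - 1) = vtx (i + N%:Z).
Proof. by rewrite -vtx_period; congr vtx; lia. Qed.

(** At most N steps from v_i wrap around at most once, so congruences reduce to a linear case
    distinction. *)
Lemma vtx_add i (t : nat) : (t <= N)%N ->
  (vtx i + t <= N /\ vtx (i + t%:Z) = vtx i + t :> nat \/
   N < vtx i + t /\ vtx (i + t%:Z) + N.+1 = vtx i + t)%N.
Proof.
move=> tN; have vN := ltn_ord (vtx i); have := val_vtx (i + t%:Z).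
rewrite -modzDml -(val_vtx i); case: (leqP (vtx i + t) N) => le.
  by rewrite modz_small; lia.
by rewrite -(modzMDl (-1)) modz_small; lia.
Qed.

(** The number of x when the numbering starts at v_i; inverse to t -> v_(i+t) on 0, ..., N. *)
Definition offset (i : int) (x : 'I_N.+1) : nat :=
  if (vtx i <= x)%N then (x - vtx i)%N else (x + N.+1 - vtx i)%N.

Lemma offsetP i (x : 'I_N.+1) :
  (vtx i <= x /\ offset i x + vtx i = x \/
   x < vtx i /\ offset i x + vtx i = x + N.+1)%N.
Proof. by rewrite /offset; have := ltn_ord (vtx i); case: (leqP (vtx i) x); lia. Qed.

Lemma offset_le i x : (offset i x <= N)%N.
Proof. by have := offsetP i x; have := ltn_ord x; have := ltn_ord (vtx i); lia. Qed.

Lemma offsetK i x : vtx (i + (offset i x)%:Z) = x.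
Proof.
apply/val_inj => /=; have := vtx_add i (offset_le i x); have := offsetP i x.
by have := ltn_ord x; have := ltn_ord (vtx i); lia.
Qed.

Lemma vtx_inj i (a b : nat) : (a <= N)%N -> (b <= N)%N ->
  vtx (i + a%:Z) = vtx (i + b%:Z) -> a = b.
Proof.
move=> aN bN ab; have := vtx_add i aN; have := vtx_add i bN; rewrite ab.
by have := ltn_ord (vtx i); lia.
Qed.

Lemma vtx_eqE (x : 'I_N.+1) u : ((x : nat)%:Z == u %[mod N.+1%:Z])%Z = (x == vtx u).
Proof.
rewrite -val_eqE -eqz_nat val_vtx modz_small //.
by have := ltn_ord x; lia.
Qed.

Lemma vertices1 u : vertices N.+1 [:: u] = [set vtx u].
Proof. by apply/setP=> x; rewrite !inE /= orbF vtx_eqE. Qed.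

Lemma vertices3 a b g : vertices N.+1 [:: a; b; g] = [set vtx a; vtx b; vtx g].
Proof. by apply/setP=> x; rewrite !inE /= !vtx_eqE orbF orbA. Qed.

Lemma boundary_vtx u : boundary_edge (vtx u) (vtx (u + 1)).
Proof.
apply/orP; left; have uN := ltn_ord (vtx u).
have [|[le ->]|[le u1]] := @vtx_add u 1%N; first by lia.
  by rewrite addn1 modn_small //; lia.
have -> : (vtx u).+1 = N.+1 by lia.
by move: (u1 : (vtx (u + 1) + N.+1 = vtx u + 1)%N); rewrite modnn; lia.
Qed.

Section Triangulation.
Context (T : {set 'I_N.+1 * 'I_N.+1}) (hT : triangulation T).

Lemma sideC x y : side T x y = side T y x.
Proof. by rewrite /side /boundary_edge orbC -!orbA; do !bool_congr. Qed.

Lemma side_diagonal (x y : 'I_N.+1) : (x.+1 < y)%N -> (0 < x)%N || (y < N)%N ->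
  side T x y -> (x, y) \in T.
Proof.
case: hT => _ diag _ xy xyN; have yN := ltn_ord y.
case/or3P => // [/orP[]|/diag]; last by rewrite /diagonal /=; lia.
  by rewrite modn_small; lia.
case: (ltnP y N) => yN1; first by rewrite modn_small; lia.
have -> : y.+1 = N.+1 by lia.
by rewrite modnn; lia.
Qed.

Lemma side_noncrossing (x z y w : 'I_N.+1) :
  (x < z)%N -> (z < y)%N -> (y < w)%N -> side T x y -> side T z w -> False.
Proof.
move=> xz zy yw sxy szw; have wN := ltn_ord w.
have Txy : (x, y) \in T by apply: side_diagonal => //; lia.
have Tzw : (z, w) \in T by apply: side_diagonal => //; lia.
case: hT => _ _ /(_ _ _ Txy Tzw) /negP; apply.
by rewrite /crossing /= xz zy yw.
Qed.

Definition arc (i : int) : rel nat :=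
  fun a b => side T (vtx (i + a%:Z)) (vtx (i + b%:Z)).

(** Depending on how many of the four positions wrap around, the actual vertices are increasing
    after a cyclic rotation, and rotation preserves the crossing of two chords. *)
Lemma arc_noncrossing i : noncrossing N (arc i).
Proof.
move=> a b c d ab bc cd dN; rewrite /arc => sac sbd.
have := @vtx_add i a; have := @vtx_add i b; have := @vtx_add i c; have := @vtx_add i d.
have := ltn_ord (vtx i).
move: (vtx (i + a%:Z)) (vtx (i + b%:Z)) (vtx (i + c%:Z)) (vtx (i + d%:Z)) sac sbd.
move=> A B C D sAC sBD i0 hd hc hb ha.
have {}hd := hd ltac:(lia); have {}hc := hc ltac:(lia).
have {}hb := hb ltac:(lia); have {}ha := ha ltac:(lia).
have sCA : side T C A by rewrite sideC.
have sDB : side T D B by rewrite sideC.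
case: (leqP (vtx i + d) N) => id.
  by apply: (@side_noncrossing A B C D) => //; lia.
case: (leqP (vtx i + c) N) => ic.
  by apply: (@side_noncrossing D A B C) => //; lia.
case: (leqP (vtx i + b) N) => ib.
  by apply: (@side_noncrossing C D A B) => //; lia.
case: (leqP (vtx i + a) N) => ia.
  by apply: (@side_noncrossing B C D A) => //; lia.
by apply: (@side_noncrossing A B C D) => //; lia.
Qed.

Lemma side_vtxS u : side T (vtx u) (vtx (u + 1)).
Proof. by rewrite /side boundary_vtx. Qed.

Lemma arc_edge i a : arc i a a.+1.
Proof. by rewrite /arc -(addn1 a) PoszD addrA side_vtxS. Qed.

Lemma arc_base i : arc i 0 N.
Proof. by rewrite /arc addr0 -vtx_pred sideC -{2}(subrK 1 i); exact: side_vtxS. Qed.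

(** Renumbering sends the N - 2 diagonals injectively to long arcs, none of them the base; with the
    base this makes N - 1, the extremal number. *)
Lemma card_arcs i : (N <= (count_long_arcs N (arc i) 0 N).+1)%N.
Proof.
pose f (p : 'I_N.+1 * 'I_N.+1) : 'I_N.+1 * 'I_N.+1 :=
  (inord (minn (offset i p.1) (offset i p.2)),
   inord (maxn (offset i p.1) (offset i p.2))).
have f1 p : (f p).1 = minn (offset i p.1) (offset i p.2) :> nat.
  by rewrite inordK //; have := offset_le i p.1; have := offset_le i p.2; lia.
have f2 p : (f p).2 = maxn (offset i p.1) (offset i p.2) :> nat.
  by rewrite inordK //; have := offset_le i p.1; have := offset_le i p.2; lia.
have [cT diag _] := hT; have i0 := ltn_ord (vtx i).
have base_out : (ord0, ord_max) \notin f @: T.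
  apply/imsetP=> -[[x y] /diag xy eqf]; move: (f1 (x, y)) (f2 (x, y)).
  rewrite -eqf /=; move: xy; rewrite /diagonal /=.
  have := offsetP i x; have := offsetP i y.
  by have := ltn_ord x; have := ltn_ord y; lia.
have f_inj : {in T &, injective f}.
  move=> [x y] [x' y'] /diag xy /diag xy' eqf.
  have e1 : (f (x, y)).1 = (f (x', y')).1 :> nat by rewrite eqf.
  have e2 : (f (x, y)).2 = (f (x', y')).2 :> nat by rewrite eqf.
  move: e1 e2 xy xy'; rewrite !f1 !f2 /diagonal /= => e1 e2 xy xy'.
  have := offsetP i x; have := offsetP i y; have := offsetP i x'; have := offsetP i y'.
  have := ltn_ord x; have := ltn_ord y; have := ltn_ord x'; have := ltn_ord y'.
  by move=> *; congr pair; apply/val_inj => /=; lia.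
have sub : (ord0, ord_max) |: f @: T \subset long_arcs N (arc i) 0 N.
  apply/subsetP=> p; rewrite in_setU1 => /orP[/eqP ->|/imsetP[[x y] xyT ->]].
    by rewrite inE /= leqnn arc_base andbT; lia.
  rewrite inE; have xy := diag _ xyT.
  have -> : arc i (f (x, y)).1 (f (x, y)).2.
    rewrite f1 f2 /arc /=; case: leqP => _; rewrite !offsetK //; last rewrite sideC.
      by rewrite /side xyT orbT.
    by rewrite /side xyT orbT.
  rewrite f1 f2 andbT; have := offset_le i x; have := offset_le i y.
  move: xy; rewrite /diagonal /=; have := offsetP i x; have := offsetP i y.
  by have := ltn_ord x; have := ltn_ord y; lia.
have := subset_leq_card sub; rewrite cardsU1 base_out card_in_imset // cT => le.
have N_le : (N <= (true + (N.+1 - 3)).+1)%N by lia.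
by rewrite (leq_trans N_le) // ltnS; exact: le.
Qed.

Lemma arc_triangulated i : triangulated N (arc i).
Proof.
apply: triangulated_of_card; [exact: arc_noncrossing | by move=> a _; exact: arc_edge
  | by lia | exact: card_arcs].
Qed.

End Triangulation.
End Vertices.

(** In the descent from the base, the arc (0, t) appears as the left side of a cell below some (0,
    y), and y is the apex sought. *)
Lemma arc_outer_apex N e t : triangulated N e -> 0 < t -> t < N -> e 0 t ->
  exists z, [/\ t < z, z <= N, e 0 z & e t z].
Proof.
move=> tr t0 tN e0t.
suff H : forall x y, x < y -> y <= N -> e x y -> x = 0 -> y < N ->
    exists z, [/\ y < z, z <= N, e 0 z & e y z].
  by apply: (H 0) => //; exact: ltnW.
apply: (arc_ind tr); first by rewrite ltnn.
move=> x g y xg gy yN exg egy exy _; split; last by lia.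
by move=> x0 _; exists y; rewrite -x0.
Qed.

(** * Cells at a vertex and the quiddity *)

Section Quiddity.
Context (N : nat) (N2 : 2 <= N).
Context (T : {set 'I_N.+1 * 'I_N.+1}) (hT : triangulation T).
Local Open Scope ring_scope.

(** The right-hand side depends only on the vertex v_(i+g), so the root can be moved to that vertex,
    where its cells are easy to list. *)
Lemma degree_arc i g : (g <= N)%N -> degree N (arc T i) g =
  #|[set y | (y != vtx N (i + g%:Z)) && side T (vtx N (i + g%:Z)) y]|.
Proof.
move=> gN; pose h (b : 'I_N.+1) := vtx N (i + (b : nat)%:Z).
have h_inj : injective h.
  by move=> a b /(vtx_inj N2 (leq_ord a) (leq_ord b)) ab; apply/val_inj.
rewrite -sum1dep_card (reindex_inj h_inj) /= big_mkcond /=.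
have -> : (\sum_(b < N.+1) (if (h b != vtx N (i + g%:Z)) && side T (vtx N (i + g%:Z)) (h b)
                 then 1 else 0) = \sum_(b < N.+1) ((b != g :> nat) && arc T i g b : nat))%N.
  apply: eq_bigr => b _; rewrite /arc -/(h b).
  have -> : (h b == vtx N (i + g%:Z)) = (b == g :> nat).
    apply/eqP/eqP => [/(vtx_inj N2 (leq_ord b) gN)|bg] //.
    by rewrite /h bg.
  by case: (_ && _).
rewrite -(big_mkord xpredT (fun b => ((b != g) && arc T i g b : nat))).
rewrite (big_cat_nat (leq0n g) (leqW gN)) /= [X in (_ + X)%N]big_ltn // eqxx /= add0n.
congr (_ + _)%N; apply: eq_big_nat => b /andP[lob hib].
  by rewrite [in RHS]/arc sideC neq_ltn hib.
by rewrite neq_ltn lob orbT.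
Qed.

Lemma degree_root i g : (g <= N)%N ->
  degree N (arc T i) g = degree N (arc T (i + g%:Z)) 0.
Proof. by move=> gN; rewrite !degree_arc // addr0. Qed.

Lemma cell3 (x y z : 'I_N.+1) : x != y -> x != z -> y != z ->
  side T x y -> side T x z -> side T y z -> [set x; y; z] \in cells T.
Proof.
move=> xy xz yz sxy sxz syz; rewrite inE; apply/andP; split.
  by rewrite setUC cardsU1 cards2 !inE negb_or ![z == _]eq_sym xy xz yz.
apply/forall_inP=> u; rewrite !inE -orbA => uxyz.
apply/forall_inP=> v; rewrite !inE -orbA => vxyz; apply/implyP.
by case/or3P: uxyz => /eqP->; case/or3P: vxyz => /eqP->; rewrite ?eqxx // 1?sideC.
Qed.

Lemma cell_side C x y : C \in cells T -> x \in C -> y \in C -> x != y -> side T x y.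
Proof.
rewrite inE => /andP[_ /forall_inP sC] xC yC xy.
by have /forall_inP /(_ y yC) /implyP := sC x xC; apply.
Qed.

Section AtVertex.
Context (v : int).
Local Notation e := (arc T v).
Local Notation p t := (vtx N (v + (t : nat)%:Z)).

Lemma vtx_neq (a b : nat) : (a <= N)%N -> (b <= N)%N -> a != b -> p a != p b.
Proof. by move=> aN bN; apply: contraNneq => /(vtx_inj N2 aN bN) ->. Qed.

Definition outer_apex (t : 'I_N.+1) : 'I_N.+1 :=
  odflt ord0 [pick z : 'I_N.+1 | [&& (t < z)%N, e 0 z & e t z]].

Lemma outer_apexP (t : 'I_N.+1) : (0 < t)%N -> (t < N)%N -> e 0 t ->
  [/\ (t < outer_apex t)%N, e 0 (outer_apex t) & e t (outer_apex t)].
Proof.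
move=> t0 tN e0t; rewrite /outer_apex; case: pickP => [z /and3P[]|none] //=.
have [z [tz zN e0z etz]] := arc_outer_apex (arc_triangulated N2 hT v) t0 tN e0t.
by have := none (Ordinal (zN : z < N.+1)%N); rewrite /= tz e0z etz.
Qed.

(** For two candidates z < w, the arcs (0, z) and (t, w) would cross. *)
Lemma outer_apex_eq (t z : 'I_N.+1) : (0 < t)%N -> (t < z)%N ->
  e 0 t -> e 0 z -> e t z -> outer_apex t = z.
Proof.
move=> t0 tz e0t e0z etz; have zN := leq_ord z.
have [tw e0w etw] := outer_apexP t0 (leq_trans tz zN) e0t.
apply/val_inj/eqP; rewrite /= eqn_leq; apply/andP; split; rewrite leqNgt; apply/negP => lt.
  exact: (arc_noncrossing N2 hT t0 tz lt (leq_ord _) e0z etw).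
exact: (arc_noncrossing N2 hT t0 tw lt zN e0w etz).
Qed.

Definition inner_neighbours : {set 'I_N.+1} :=
  [set t : 'I_N.+1 | [&& (0 < t)%N, (t < N)%N & e 0 t]].

(* The cells at v correspond to the neighbours of v other than v - 1, each cell
   to its first side at v. *)
Definition fan_cell (t : 'I_N.+1) : {set 'I_N.+1} :=
  [set p 0%N; p t; p (outer_apex t)].

(** If t and u were different, each would be the outer apex of the other, although an outer apex has
    a larger number than its vertex. *)
Lemma fan_cell_inj : {in inner_neighbours &, injective fan_cell}.
Proof.
move=> t u; rewrite !inE => /and3P[t0 tN e0t] /and3P[u0 uN e0u] tu.
have [tz _ _] := outer_apexP t0 tN e0t.
have [uz _ _] := outer_apexP u0 uN e0u.
have inj (a b : 'I_N.+1) : p a = p b -> a = b :> nat.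
  by move=> ab; apply: (vtx_inj N2 (leq_ord a) (leq_ord b) ab).
have : p t \in fan_cell u by rewrite -tu !inE eqxx orbT.
have : p u \in fan_cell t by rewrite tu !inE eqxx orbT.
rewrite !inE -!orbA => /or3P Hu /or3P Ht; apply/val_inj => /=.
case: Hu => /eqP; [move/(inj _ ord0) => /=; lia | by move/inj | move/inj=> Hu].
case: Ht => /eqP; [move/(inj _ ord0) => /=; lia | by move/inj | move/inj=> Ht].
by lia.
Qed.

Lemma fan_cells :
  fan_cell @: inner_neighbours = [set C in cells T | vertices N.+1 [:: v] \subset C].
Proof.
apply/setP=> C; rewrite inE vertices1 // sub1set; apply/imsetP/andP.
  case=> t; rewrite inE => /and3P[t0 tN e0t] ->.
  have [tz e0z etz] := outer_apexP t0 tN e0t; have zN := leq_ord (outer_apex t).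
  split; last by rewrite !inE addr0 eqxx.
  by apply: cell3 => //; apply: vtx_neq; lia.
case=> cC vC; have C3 : #|C| = 3%N by move: cC; rewrite inE => /andP[/eqP].
have /cards2P[x [y [xy Cxy]]] : #|C :\ vtx N v| == 2%N.
  by have := cardsD1 (vtx N v) C; rewrite C3 vC add1n => /eqP; rewrite eqSS eq_sym.
have {}Cxy : C = [set vtx N v; x; y] by rewrite -(setD1K vC) Cxy setUA.
have [xv yv] : x != vtx N v /\ y != vtx N v.
  move: C3; rewrite Cxy -setUA cardsU1 cards2 xy !inE negb_or ![vtx N v == _]eq_sym.
  by case: (x == _); case: (y == _).
(* The first of the two other vertices met clockwise from v is the neighbour t; the second is then
   its outer apex by uniqueness. *)
wlog lt_xy : x y xy xv yv Cxy / (offset v x < offset v y)%N.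
  case: (ltngtP (offset v x) (offset v y)) => [lt|lt|eq_xy] H.
  - exact: (H x y).
  - by apply: (H y x) => //; rewrite 1?eq_sym // Cxy setUAC.
  - by case/eqP: xy; rewrite -(offsetK N2 v x) eq_xy offsetK.
have xC : x \in C by rewrite Cxy !inE eqxx orbT.
have yC : y \in C by rewrite Cxy !inE eqxx orbT.
have ox := offsetK N2 v x; have oy := offsetK N2 v y.
have xN := offset_le N2 v x; have yN := offset_le N2 v y.
have x0 : (0 < offset v x)%N.
  by rewrite lt0n; apply: contraNneq xv => x0; rewrite -ox x0 addr0.
pose t : 'I_N.+1 := inord (offset v x); pose z : 'I_N.+1 := inord (offset v y).
have tE : t = offset v x :> nat by rewrite inordK.
have zE : z = offset v y :> nat by rewrite inordK.
have e0t : e 0 t by rewrite /arc addr0 tE ox (cell_side cC) // eq_sym.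
have e0z : e 0 z by rewrite /arc addr0 zE oy (cell_side cC) // eq_sym.
have etz : e t z by rewrite /arc tE zE ox oy (cell_side cC).
have apex_z : outer_apex t = z by apply: outer_apex_eq; rewrite // ?tE ?zE.
exists t; first by rewrite inE e0t tE x0 andbT; exact: leq_trans lt_xy yN.
by rewrite /fan_cell apex_z addr0 tE zE ox oy.
Qed.

Lemma quiddity_root : (quiddity T v).+1 = degree N e 0.
Proof.
rewrite /quiddity -fan_cells (card_in_imset fan_cell_inj).
rewrite /degree /col big_geq // add0n (@row_cat _ _ _ _ N) //; last by lia.
rewrite row1 (arc_base N2) addn1 -sum1dep_card big_mkcond /=; congr _.+1.
rewrite -(big_mkord xpredT (fun t => if [&& (0 < t)%N, (t < N)%N & e 0 t] then 1 else 0)%N).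
rewrite big_ltn // big_nat_recr /=; last by lia.
rewrite ltnn andbF addn0; apply: eq_big_nat => t /andP[t0 tN].
by rewrite t0 tN /=; case: (e 0 t).
Qed.

End AtVertex.

Lemma quiddity_degree i g : (g <= N)%N ->
  (quiddity T (i + g%:Z)).+1 = degree N (arc T i) g.
Proof. by move=> gN; rewrite quiddity_root (degree_root i gN). Qed.

End Quiddity.

(** * Friezes *)

Local Open Scope ring_scope.

Lemma big_zrange R (op : R -> R -> R) idx (F : int -> R) i (lo hi : nat) :
  \big[op/idx]_(u <- zrange (i + lo%:Z) (i + hi%:Z - 1)) F u
    = \big[op/idx]_(lo <= t < hi) F (i + t%:Z).
Proof.
rewrite /zrange; case: (ltnP lo hi) => lohi; last first.
  have -> : i + hi%:Z - 1 - (i + lo%:Z) = Negz (lo - hi) by lia.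
  by rewrite big_nil big_geq.
have -> : i + hi%:Z - 1 - (i + lo%:Z) = Posz (hi - lo).-1 by lia.
rewrite prednK ?subn_gt0 // /index_iota.
have -> : iota lo (hi - lo) = map (addn lo) (iota 0 (hi - lo)) by rewrite -iotaDl addn0.
rewrite !big_map.
by apply: eq_bigr => t _; rewrite PoszD addrA.
Qed.

Lemma count_zrange (p : pred int) i (lo hi : nat) :
  count p (zrange (i + lo%:Z) (i + hi%:Z - 1)) = (\sum_(lo <= t < hi) p (i + t%:Z)%R)%N.
Proof.
rewrite -sum1_count big_mkcond -(big_zrange addn 0%N (fun u => nat_of_bool (p u))).
by apply: eq_bigr => u _; case: (p u).
Qed.

Lemma nu_tri_pred sigma i (g : nat) :
  nu_tri sigma (i - 1) (i + g%:Z - 1)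
    = (nu_md sigma (i - 1) (i + g%:Z - 1) + nu_tri sigma i (i + g%:Z - 1))%N.
Proof.
have -> : i + g%:Z - 1 = i - 1 + g.+1%:Z - 1 by lia.
rewrite /nu_tri -{1}(addr0 (i - 1)) big_zrange big_ltn // addr0; congr addn.
have -> : zrange i = zrange (i - 1 + 1%N%:Z) by congr zrange; lia.
by rewrite big_zrange.
Qed.

(** Holds two consecutive values f(t), f(t+1) of the solution of f(t+1) = c_t f(t) - f(t-1) with
    f(0) = 0 and f(1) = 1. *)
Fixpoint frieze_pair (c : nat -> int) (t : nat) : int * int :=
  if t is t'.+1 then
    let: (x, y) := frieze_pair c t' in (y, c t * y - x)
  else (0, 1).

Definition frieze_row (c : nat -> int) (t : nat) : int := (frieze_pair c t).1.

Lemma frieze_rowSS c t :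
  frieze_row c t.+2 = c t.+1 * frieze_row c t.+1 - frieze_row c t.
Proof. by rewrite /frieze_row /=; case: (frieze_pair c t). Qed.

(** * From frieze entries and quiddities to arc counts *)

Section Assembly.
Context (N : nat) (N2 : (2 <= N)%N).
Context (T : {set 'I_N.+1 * 'I_N.+1}) (hT : triangulation T).

Definition quiddity_row (k : int) : nat -> int :=
  frieze_row (fun t => (quiddity T (k + t%:Z))%:Z).

Lemma quiddity_rowSS k t : quiddity_row k t.+2 =
  (quiddity T (k + t.+1%:Z))%:Z * quiddity_row k t.+1 - quiddity_row k t.
Proof. exact: frieze_rowSS. Qed.

Lemma quiddity_row_rec k l : (0 < l)%N -> (l < N)%N ->
  quiddity_row k l.-1 + quiddity_row k l.+1
    = ((degree N (arc T k) l)%:Z - 1) * quiddity_row k l.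
Proof.
case: l => // l _ lN; rewrite -quiddity_degree //; last exact: ltnW.
by rewrite quiddity_rowSS /=; lia.
Qed.

(** Rows k and k + 1 solve the same second-order recurrence with leading coefficient 1, so their
    discrete Wronskian is constant. *)
Lemma quiddity_row_det k t :
  quiddity_row k t.+1 * quiddity_row (k + 1) t.+1
    - quiddity_row (k + 1) t * quiddity_row k t.+2 = 1.
Proof.
elim: t => [|t IH]; first by rewrite /quiddity_row /frieze_row /=; lia.
rewrite -[RHS]IH.
rewrite (quiddity_rowSS k t.+1) (quiddity_rowSS (k + 1) t).
by rewrite (_ : k + 1 + t.+1%:Z = k + t.+2%:Z); [ring | lia].
Qed.

Section Frieze.
Context (sigma : int -> int -> int) (hsigma : frieze N.+1 (quiddity T) sigma).

(** Both sides satisfy the unimodular rule, which determines the new entry because its coefficient,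
    an earlier entry of row k + 1, is positive. *)
Lemma frieze_quiddity_row k t : (t <= N)%N -> sigma k (k + t%:Z) = quiddity_row k t.
Proof.
case: hsigma => s0 s1 s2 srec.
elim/ltn_ind: t k => -[|[|[|t]]] IH k tN.
- by rewrite addr0 s0.
- by rewrite s1.
- by rewrite s2 /quiddity_row /frieze_row /= mulr1 subr0.
have := srec k (k + t.+3%:Z) ltac:(lia) ltac:(lia).
have -> : k + t.+3%:Z - 1 = k + t.+2%:Z by lia.
have -> : sigma (k + 1) (k + t.+3%:Z) = quiddity_row (k + 1) t.+2.
  by rewrite -IH; [congr (sigma _ _); lia | lia | lia].
have -> : sigma (k + 1) (k + t.+2%:Z) = quiddity_row (k + 1) t.+1.
  by rewrite -IH; [congr (sigma _ _); lia | lia | lia].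
rewrite IH; [|lia|lia]; rewrite -[RHS](quiddity_row_det k t.+1) => /eqP.
rewrite (inj_eq (addrI _)) eqr_opp => /eqP.
apply: mulfI; apply: lt0r_neq0.
apply: (frieze_gt0 (arc_triangulated N2 hT (k + 1))) => //; last by lia.
- by move=> l; exact: quiddity_row_rec.
- by lia.
Qed.

Lemma frieze_eq_side i (a b : nat) : (a < b)%N -> (b <= N)%N ->
  (sigma (i + a%:Z) (i + b%:Z) == 1) = arc T i a b.
Proof.
move=> ab bN; have -> : i + b%:Z = i + a%:Z + (b - a)%N%:Z by lia.
rewrite frieze_quiddity_row; last by lia.
rewrite (frieze_eq1 (arc_triangulated N2 hT (i + a%:Z))) //; [|exact: quiddity_row_rec|lia..].
by rewrite /arc addr0; congr side; congr vtx; lia.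
Qed.

(** Seen from v_i, the vertex v_(i-1) has number N; hence the ones of row i - 1 are the arcs ending
    at N. *)
Lemma frieze_eq_side_pred i (b : nat) : (b < N)%N ->
  (sigma (i - 1) (i + b%:Z) == 1) = arc T i b N.
Proof.
move=> bN; have -> : i - 1 = i - 1 + 0%N%:Z by lia.
have -> : i + b%:Z = i - 1 + b.+1%:Z by lia.
rewrite frieze_eq_side // /arc sideC addr0 (vtx_pred N2); congr side; congr vtx; lia.
Qed.

Lemma nu_triE i (lo hi : nat) : (hi <= N.+1)%N ->
  nu_tri sigma (i + lo%:Z) (i + hi%:Z - 1) = tri_count (arc T i) lo hi.
Proof.
move=> hiN; rewrite /nu_tri big_zrange; apply: eq_big_nat => a _.
have -> : i + a%:Z + 2 = i + a.+2%:Z by lia.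
rewrite count_zrange; apply: eq_big_nat => b ab; congr nat_of_bool.
by apply: frieze_eq_side; lia.
Qed.

Lemma nu_recE i (lo g hi : nat) : (hi <= N.+1)%N ->
  nu_rec sigma (i + lo%:Z) (i + g%:Z - 1) (i + hi%:Z - 1) = rec_count (arc T i) lo g hi.
Proof.
move=> hiN; rewrite /nu_rec big_zrange; apply: eq_big_nat => a ag.
have -> : i + g%:Z - 1 + 2 = i + g.+1%:Z by lia.
rewrite count_zrange; apply: eq_big_nat => b gb; congr nat_of_bool.
by apply: frieze_eq_side; lia.
Qed.

Lemma nu_mdE i (g : nat) : (g <= N)%N ->
  nu_md sigma (i - 1) (i + g%:Z - 1) = col (arc T i) N 1 g.
Proof.
move=> gN; rewrite /nu_md; have -> : i - 1 + 2 = i + 1%N%:Z by lia.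
rewrite count_zrange; apply: eq_big_nat => b gb; congr nat_of_bool.
by apply: frieze_eq_side_pred; lia.
Qed.

End Frieze.

(** Each summand is the degree minus 2, by [quiddity_degree]. *)
Lemma sum_quiddity i (lo g : nat) : (g <= N.+1)%N ->
  \sum_(u <- zrange (i + lo%:Z) (i + g%:Z - 1)) ((quiddity T u)%:Z - 1)
    = (\sum_(lo <= u < g) degree N (arc T i) u)%N%:Z - (2 * (g - lo))%N%:Z.
Proof.
move=> gN; rewrite big_zrange.
case: (leqP g lo) => glo.
  by rewrite !big_geq // (_ : g - lo = 0)%N; lia.
rewrite (_ : (2 * (g - lo))%N%:Z = \sum_(lo <= u < g) 2%:Z); last first.
  by rewrite sumr_const_nat -mulr_natr natz; lia.
rewrite (big_morph Posz PoszD erefl) -sumrB; apply: eq_big_nat => u ug.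
by rewrite -(quiddity_degree N2 hT); lia.
Qed.

Lemma qFarey_farey i r s (w : int -> int -> int) :
  (forall (b g a : int) (l : nat),
     i <= b -> b < g -> g < a -> a <= i + N.+1%:Z - 1 ->
     vertices N.+1 [:: a; b; g] \in cells T -> w b a = l%:Z - 1 ->
     [/\ r g = r a + 'X^l * r b, s g = s a + 'X^l * s b, w g a = 0 & w b g = l%:Z]) ->
  let w' a b := w (i + a%:Z) (i + b%:Z) in
  farey_labeling N (arc T i) w' (fun t => r (i + t%:Z)) /\
  farey_labeling N (arc T i) w' (fun t => s (i + t%:Z)).
Proof.
move=> hw /=.
suff H b g a l : (b < g)%N -> (g < a)%N -> (a <= N)%N ->
    arc T i b g -> arc T i g a -> arc T i b a ->
    w (i + b%:Z) (i + a%:Z) = l%:Z - 1 ->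
    [/\ r (i + g%:Z) = r (i + a%:Z) + 'X^l * r (i + b%:Z),
        s (i + g%:Z) = s (i + a%:Z) + 'X^l * s (i + b%:Z),
        w (i + g%:Z) (i + a%:Z) = 0 & w (i + b%:Z) (i + g%:Z) = l%:Z].
  by split=> b g a l bg ga aN ebg ega eba /(H _ _ _ _ bg ga aN ebg ega eba)[].
move=> bg ga aN ebg ega eba wba; apply: hw => //; try lia.
rewrite vertices3 //; apply: cell3; rewrite // 1?sideC //.
- by apply: vtx_neq; lia.
- by apply: vtx_neq; lia.
- by apply: vtx_neq; lia.
Qed.

End Assembly.

Theorem proposition4p4 (n : nat) (hn : (3 <= n)%N)
    (T : {set 'I_n * 'I_n}) (hT : triangulation T)
    (sigma : int -> int -> int) (hsigma : frieze n (quiddity T) sigma)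
    (i : int) (r s : int -> {poly int}) (hrs : qFarey_labeling T i r s) :
  ((forall j : int, i - 1 <= j -> j <= i + n%:Z - 3 ->
      [/\ r (j + 1) != 0,
          (degmin (r (j + 1)))%:Z
            = (nu_tri sigma (i - 1) j)%:Z - (nu_tri sigma i j)%:Z,
          (nu_tri sigma (i - 1) j)%:Z - (nu_tri sigma i j)%:Z
            = (nu_md sigma (i - 1) j)%:Z,
          (deg (r (j + 1)))%:Z
            = \sum_(u <- zrange i j) ((quiddity T u)%:Z - 1)
              - (nu_tri sigma i (j + 1))%:Z - (nu_tri sigma i j)%:Z &
          \sum_(u <- zrange i j) ((quiddity T u)%:Z - 1)
              - (nu_tri sigma i (j + 1))%:Z - (nu_tri sigma i j)%:Z
            = (nu_md sigma (i - 1) j)%:Z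
              + (nu_rec sigma i j (i + n%:Z - 2))%:Z])
   /\ r (i + n%:Z - 1) = 0)
  /\
  ((forall j : int, i <= j -> j <= i + n%:Z - 2 ->
      [/\ s (j + 1) != 0,
          degmin (s (j + 1)) = 0%N,
          (deg (s (j + 1)))%:Z
            = \sum_(u <- zrange (i + 1) j) ((quiddity T u)%:Z - 1)
              - (nu_tri sigma (i + 1) (j + 1))%:Z - (nu_tri sigma i j)%:Z &
          \sum_(u <- zrange (i + 1) j) ((quiddity T u)%:Z - 1)
              - (nu_tri sigma (i + 1) (j + 1))%:Z - (nu_tri sigma i j)%:Z
            = (nu_rec sigma (i + 1) j (i + n%:Z - 1))%:Z])
   /\ s i = 0).
Proof.
case: n hn T hT hsigma hrs => // N N2 T hT hsigma [w [w0 [rN sN] [ri si] hw]].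
have N0 : (0 < N)%N := ltnW N2.
have tr := arc_triangulated N2 hT i.
have [hr hs] := qFarey_farey N2 hw.
have iN : i + N.+1%:Z - 1 = i + N%:Z by lia.
rewrite iN in w0 rN sN *.
have w0' : w (i + 0%N%:Z) (i + N%:Z) = -1 by rewrite addr0.
have tri0 (h : nat) : (h <= N.+1)%N ->
    nu_tri sigma i (i + h%:Z - 1) = tri_count (arc T i) 0 h.
  by move=> hN; rewrite -{1}(addr0 i) (nu_triE N2 hT hsigma).
split; split=> // j lej jle.
  (* The label of index j + 1 belongs to the vertex numbered g, and ranges ending at j become
     half-open ranges ending at g. *)
  have [g jE] : exists g : nat, j = i + g%:Z - 1 by exists (absz (j + 1 - i)%R); lia.
  have gN : (g < N)%N by lia.
  have ri' : r (i + 0%N%:Z) = 1 by rewrite addr0.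
  have := numerator_spans tr N0 w0' hr ri' rN gN.
  rewrite over_numerator // => sp; have deg_sum := sum_degree_numerator tr gN.
  have -> : j + 1 = i + g%:Z by lia.
  rewrite (spans_deg sp) (spans_degmin sp) (spans_neq0 sp) jE.
  have -> : i + N.+1%:Z - 2 = i + N%:Z - 1 by lia.
  have -> : nu_tri sigma i (i + g%:Z) = tri_count (arc T i) 0 g.+1.
    by rewrite -tri0 //; [congr nu_tri; lia | lia].
  rewrite nu_tri_pred tri0 ?(nu_mdE N2 hT hsigma) //; try lia.
  have quid_sum := sum_quiddity N2 hT i 0 (leqW (ltnW gN)).
  have := nu_recE N2 hT hsigma i 0 g (leqnSn N).
  rewrite addr0 in quid_sum *; rewrite quid_sum deg_sum => ->.
  by split=> //; lia.
have [g jE] : exists g : nat, j = i + g%:Z - 1 by exists (absz (j + 1 - i)%R); lia.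
have gN : (g <= N)%N by lia.
have g0 : (0 < g)%N by lia.
have si' : s (i + 0%N%:Z) = 0 by rewrite addr0.
have := denominator_spans tr N0 w0' hs si' sN g0 gN.
rewrite over_denominator => sp; have deg_sum := sum_degree_denominator tr g0 gN.
have -> : j + 1 = i + g%:Z by lia.
rewrite (spans_deg sp) (spans_degmin sp) (spans_neq0 sp) jE.
have -> : i + N%:Z = i + N.+1%:Z - 1 by lia.
have -> : nu_tri sigma (i + 1) (i + g%:Z) = tri_count (arc T i) 1 g.+1.
  by rewrite -(nu_triE N2 hT hsigma) //; congr nu_tri; lia.
rewrite tri0 ?(leqW gN) //.
have := sum_quiddity N2 hT i 1 (leqW gN); rewrite deg_sum => ->.
have -> := nu_recE N2 hT hsigma i 1 g (leqnn N.+1).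
by split=> //; lia.
Qed.
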